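(* Let $n\ge 1$ and let $A_{\mathbb{F}_2^n}$ be the $3$-dimensional convolution matrix of the additive group $\mathbb{F}_2^n$. Then for all nonnegative integers $k_0,k_1,k_2$ with $k_0+k_1+k_2\le n$, the number $2^{k_0-k_1-k_2}\,(-1+i\sqrt7)^{k_1}(-1-i\sqrt7)^{k_2}$ is an eigenvalue of $A_{\mathbb{F}_2^n}$.
   Context: For a finite abelian group $G$, the convolution matrix $A_G$ is the $3$-dimensional $(0,1)$-array $(a_{x,y,z})_{x,y,z\in G}$ with $a_{x,y,z}=1$ if $x=y+z$ and $a_{x,y,z}=0$ otherwise. For $f:G\to\mathbb{C}$, $(A_G\circ f)(x)=\sum_{y,z\in G}a_{x,y,z}f(y)f(z)$. A number $\theta\in\mathbb{C}$ is an eigenvalue of $A_G$ if there is a function $f:G\to\mathbb{C}$, $f\not\equiv 0$ (an eigenfunction), such that $(A_G\circ f)(x)=\theta f(x)^2$ for all $x\in G$. *)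

(* Defs.v *)
(* For R : realType, R[i] is the field of complex numbers. *)
From mathcomp Require Import all_boot all_order all_algebra.
From mathcomp Require Import reals complex.

Set Implicit Arguments.
Unset Strict Implicit.
Unset Printing Implicit Defensive.

Import GRing.Theory.
Local Open Scope ring_scope.
Local Open Scope complex_scope.

(* A finZmodType is a finite abelian group in additive notation; G is explicit
   so that a carrier such as 'rV['F_2]_n can be passed directly. *)
Definition convolution_array (R : realType) (G : finZmodType) :
    G -> G -> G -> R[i] :=
  fun x y z => (x == y + z)%:R.
Arguments convolution_array R G : clear implicits.

Definition array_action (R : realType) (X : finType)
    (A : X -> X -> X -> R[i]) (f : X -> R[i]) : X -> R[i] :=
  fun x => \sum_(y : X) \sum_(z : X) A x y z * f y * f z.

Definition array_eigenvalue (R : realType) (X : finType)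
    (A : X -> X -> X -> R[i]) (theta : R[i]) : Prop :=
  exists f : X -> R[i],
    (exists x : X, f x <> 0) /\
    (forall x : X, array_action A f x = theta * f x ^+ 2).

(* Main.v *)
Require Import Defs.
From mathcomp Require Import all_boot all_order all_algebra.
From mathcomp Require Import reals complex.
From mathcomp Require Import ring.

(** The convolution array of a power [G^n] is the n-th tensor power of the
    convolution array of [G], so a product [x |-> \prod_i g_i(x_i)] of
    eigenfunctions on [G] is an eigenfunction on [G^n], with the product of the
    eigenvalues ([array_eigenvalue_prod]). It therefore suffices to find the
    eigenvalues of [F_2]. There an eigenfunction with values [a] at 0 and [b]
    at 1 must satisfy
      [a^2 + b^2 = theta a^2]  and  [2 a b = theta b^2].
    The choice [b = 0] gives [theta = 1]. Otherwise one can scale so that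
    [b = 2], whence [a = theta], and what remains is
      [theta^3 - theta^2 - 4 = (theta - 2)(theta^2 + theta + 2) = 0],
    with roots 2 and [(-1 +- i sqrt 7)/2] ([array_eigenvalue_F2]). The number
    in the theorem is the product of [k0] copies of 2, [k1] and [k2] copies of
    the two complex roots, and [n - k0 - k1 - k2] copies of 1. *)

Set Implicit Arguments.
Unset Strict Implicit.
Unset Printing Implicit Defensive.

Import GRing.Theory Num.Theory.
Local Open Scope ring_scope.
Local Open Scope complex_scope.

Lemma array_action_convolution (R : realType) (G : finZmodType)
    (f : G -> R[i]) (x : G) :
  array_action (convolution_array R G) f x = \sum_y f y * f (x - y).
Proof.
apply: eq_bigr => y _; rewrite (bigD1 (x - y)) //= big1 => [|z neq_z].
  by rewrite /convolution_array (addrC y) subrK eqxx mul1r addr0.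
rewrite /convolution_array; case: eqP => [def_x|_]; last by rewrite !mul0r.
by rewrite def_x addrC addKr eqxx in neq_z.
Qed.

(** Distributivity turns the sum over all of [G^n] of a product over the
    coordinates into the product of the one-coordinate sums, which is what
    makes convolution compatible with tensor products. *)
Lemma array_action_tensor (R : realType) (G : finZmodType) (n : nat)
    (g : 'I_n -> G -> R[i]) (x : 'rV[G]_n) :
  array_action (convolution_array R 'rV[G]_n)
      (fun v => \prod_i g i (v 0 i)) x
    = \prod_i array_action (convolution_array R G) (g i) (x 0 i).
Proof.
rewrite array_action_convolution.
under [RHS]eq_bigr do rewrite array_action_convolution.
rewrite bigA_distr_bigA /=.
rewrite (reindex (fun h : {ffun 'I_n -> G} => \row_i h i)) /=.
  apply: eq_bigr => h _; rewrite -big_split /=.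
  by apply: eq_bigr => i _; rewrite !mxE.
exists (fun v : 'rV[G]_n => [ffun i => v 0 i]) => [h _|v _].
  by apply/ffunP => i; rewrite ffunE mxE.
by apply/rowP => i; rewrite mxE ffunE.
Qed.

Lemma array_eigenvalue_prod (R : realType) (G : finZmodType) (n : nat)
    (theta : 'I_n -> R[i]) :
    (forall i, array_eigenvalue (convolution_array R G) (theta i)) ->
  array_eigenvalue (convolution_array R 'rV[G]_n) (\prod_i theta i).
Proof.
move=> /fin_all_exists[g eigen_g].
have /fin_all_exists[p gp_neq0] i : exists x, g i x <> 0.
  by case: (eigen_g i).
exists (fun v : 'rV[G]_n => \prod_i g i (v 0 i)); split=> [|x].
  exists (\row_i p i); apply/eqP/prodf_neq0 => i _.
  by rewrite mxE; apply/eqP.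
rewrite array_action_tensor -prodrXl -big_split /=.
by apply: eq_bigr => i _; case: (eigen_g i).
Qed.

Lemma array_action_F2 (R : realType) (f : 'F_2 -> R[i]) (x : 'F_2) :
  array_action (convolution_array R 'F_2) f x
    = f 0 * f x + f 1 * f (x - 1).
Proof.
rewrite array_action_convolution big_ord_recl big_ord1.
have -> : ord0 = 0 :> 'F_2 by [].
have -> : lift ord0 ord0 = 1 :> 'F_2 by apply: val_inj.
by rewrite subr0.
Qed.

Lemma F2_cases (x : 'F_2) : x = 0 \/ x = 1.
Proof. by case: x => [[|[|//]] ltx2]; [left | right]; apply: val_inj. Qed.

(** The Dirac mass at 0 is idempotent for convolution. *)
Lemma array_eigenvalue1_F2 (R : realType) :
  array_eigenvalue (convolution_array R 'F_2) 1.
Proof.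
exists (fun x : 'F_2 => (x == 0)%:R); split=> [|x].
  by exists 0; apply/eqP; rewrite eqxx oner_eq0.
rewrite array_action_F2 eqxx oner_eq0 !mul1r mul0r addr0.
by case: (x == 0); rewrite ?expr1n ?expr0n.
Qed.

(** The eigenvalues coming from eigenfunctions that do not vanish at 1; the
    equation at 1 forces the ratio of the two values to be [theta : 2], and
    the equation at 0 becomes the cubic. *)
Lemma array_eigenvalue_F2 (R : realType) (theta : R[i]) :
    (theta - 2) * (theta ^+ 2 + theta + 2) = 0 ->
  array_eigenvalue (convolution_array R 'F_2) theta.
Proof.
move=> cubic; exists (fun x : 'F_2 => if x == 0 then theta else 2); split=> [|x].
  by exists 1; apply/eqP; rewrite /= pnatr_eq0.
rewrite array_action_F2 eqxx oner_eq0.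
have [->|->] := F2_cases x; last by rewrite subrr eqxx oner_eq0; ring.
rewrite eqxx sub0r oppr_eq0 oner_eq0.
by apply/eqP; rewrite eq_sym -subr_eq0 -cubic; apply/eqP; ring.
Qed.

(** The quadratic factor is [((2 theta + 1)^2 + 7) / 4]. *)
Lemma array_eigenvalue_sqrtN7_F2 (R : realType) (d : R[i]) :
    d ^+ 2 = -7 ->
  array_eigenvalue (convolution_array R 'F_2) ((-1 + d) / 2).
Proof.
move=> d2; apply: array_eigenvalue_F2.
suff -> : ((-1 + d) / 2) ^+ 2 + (-1 + d) / 2 + 2 = 0 by rewrite mulr0.
transitivity ((d ^+ 2 + 7) / 4); first by field.
by rewrite d2 addNr mul0r.
Qed.

Lemma sqr_i_sqrt7 (R : realType) :
  ('i%C * (Num.sqrt (7 : R))%:C) ^+ 2 = -7 :> R[i].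
Proof.
by rewrite exprMn sqr_i -rmorphXn /= sqr_sqrtr ?ler0n // mulN1r rmorph_nat.
Qed.

Theorem theorem2 (R : realType) (n : nat) (hn : (1 <= n)%N)
    (k0 k1 k2 : nat) (hk : (k0 + k1 + k2 <= n)%N) :
  array_eigenvalue (convolution_array R 'rV['F_2]_n)
    ((2 : R[i]) ^ (k0%:Z - k1%:Z - k2%:Z)
     * (-1 + 'i%C * (Num.sqrt (7 : R))%:C) ^+ k1
     * (-1 - 'i%C * (Num.sqrt (7 : R))%:C) ^+ k2).
Proof.
have d2 := sqr_i_sqrt7 R; set d := 'i%C * _ in d2 *.
pose s : seq R[i] := nseq k0 2 ++ nseq k1 ((-1 + d) / 2)
  ++ nseq k2 ((-1 - d) / 2) ++ nseq (n - (k0 + k1 + k2)) 1.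
have size_s : size s = n.
  by rewrite !size_cat !size_nseq !addnA subnKC.
have eigen_s theta : theta \in s ->
    array_eigenvalue (convolution_array R 'F_2) theta.
  rewrite !mem_cat !mem_nseq => /or4P[] /andP[_ /eqP->].
  - by apply: array_eigenvalue_F2; rewrite subrr mul0r.
  - exact: array_eigenvalue_sqrtN7_F2.
  - by apply: array_eigenvalue_sqrtN7_F2; rewrite sqrrN.
  - exact: array_eigenvalue1_F2.
have <- : \prod_(i < n) s`_i = 2 ^ (k0%:Z - k1%:Z - k2%:Z)
    * (-1 + d) ^+ k1 * (-1 - d) ^+ k2.
  rewrite -size_s -(big_mkord xpredT (fun i => s`_i)) -(big_nth 0 xpredT id).
  rewrite !big_cat !big_nseq /= !iter_mulr_1 expr1n mulr1 !expr_div_n.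
  rewrite !expfzDr ?pnatr_eq0 // -!exprnN -exprnP.
  by ring.
apply: array_eigenvalue_prod => i; apply: eigen_s.
by rewrite mem_nth // size_s.
Qed.
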